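(* Let $$c_0:=\max_{\frac13\le\alpha\le\frac12}\left(-\log\alpha+(\log(1-\alpha)-\log\alpha)\log\alpha-\int_\alpha^{1-\alpha}\frac{\log(1-t)}{t}\,dt\right)=0.82849\dots$$ Then for every integer $d\ge2$ and every positive integer $k$ with $d\nmid k$, $$\liminf_{n\to\infty}\frac{f_{k,d}(n)}{n}\ge c_0.$$
   Context: $\log$ is the natural logarithm. $f_{k,d}(n)$ is the maximal size of a set $A\subseteq\{1,\dots,n\}$ such that the equation $a_1a_2\cdots a_k=x^d$ (with $a_1,\dots,a_k\in A$ not necessarily distinct, $x$ an integer) has no solution except trivial ones, where a solution is trivial if the multiset $\{a_1,\dots,a_k\}$ can be partitioned into $d$-element sub-multisets each consisting of $d$ copies of the same number (when $d\nmid k$ there are no trivial solutions). *)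

(* Defs.v *)
From Stdlib Require Import Reals ZArith.
From mathcomp Require Import all_boot boolp.
From Coquelicot Require Import Coquelicot.

Set Implicit Arguments.
Unset Strict Implicit.
Unset Printing Implicit Defensive.

(* The multiset underlying s splits into blocks, each consisting of d copies of
   one number; bs lists the numbers, one entry per block. *)
Definition trivial_solution (d : nat) (s : seq nat) : Prop :=
  exists bs : seq nat, perm_eq s (flatten [seq nseq d b | b <- bs]).

(* Subsets of {1, ..., n} are the sets of ordinals in {0, ..., n} without 0. *)
Definition only_trivial_solutions (k d n : nat) (A : {set 'I_n.+1}) : Prop :=
  ord0 \notin A /\
  forall (a : k.-tuple 'I_n.+1) (x : Z),
    (forall i : 'I_k, tnth a i \in A) ->
    Z.of_nat (\prod_(i < k) tnth a i)%N = Z.pow x (Z.of_nat d) ->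
    trivial_solution d [seq nat_of_ord b | b <- a].

Definition max_size (k d n : nat) : nat :=
  \max_(A : {set 'I_n.+1} | `[< only_trivial_solutions k d A >]) #|A|.

Local Open Scope R_scope.

Definition c0_objective (alpha : R) : R :=
  - ln alpha + (ln (1 - alpha) - ln alpha) * ln alpha
  - RInt (fun t => ln (1 - t) / t) alpha (1 - alpha).

Definition c0_values (y : R) : Prop :=
  exists alpha : R, 1 / 3 <= alpha <= 1 / 2 /\ y = c0_objective alpha.

(* Defined as a supremum; that it is a maximum is a separate assertion. *)
Definition c0 : R := real (Lub_Rbar c0_values).

Definition is_maximum (E : R -> Prop) (m : R) : Prop :=
  E m /\ forall y : R, E y -> y <= m.

(* Main.v *)
From HB Require Import structures.
Require Import Defs.
From Stdlib Require Import Reals ZArith Lra.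
From mathcomp Require Import all_boot boolp zify.
From Coquelicot Require Import Coquelicot.

(* Let [A] be the set of [m <= n] with exactly one prime factor above [n ^ u],
   counted with multiplicity.  The number of large prime factors is completely
   additive, so a product of [k] elements of [A] has [k] of them, whereas a
   [d]-th power has a multiple of [d]: if [d] does not divide [k], the equation
   has no solution at all.  Counting the multiples of large primes and removing
   those of products of two large primes gives
     #|A| >= sum_p floor(n / p) - sum_(p, q) floor(n / (p q)),
   and Mertens' second theorem shows that the right-hand side is asymptotically
   at least [n * c0_objective u].  The objective is maximal at
   [u = 1 / (1 + sqrt e)]. *)

Local Open Scope R_scope.

(** * The constant *)

(** Heuristically the primes p = n^x have density dx / x. After division by n, the single sum then
    tends to ln (1 / u) and the pair sum to the integral of ln ((1 - x) / u) / x over u <= x <= 1 -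
    u; the difference of the two is [c0_objective u]. For u >= 1/3 no m <= n has three large prime
    factors, and removing ordered pairs (p, q) is then exact; the lower end 1/3 of the range of
    alpha reflects this. Only sums of 1 / p between two powers of n occur, so neither the constant
    in Mertens' second theorem nor partial summation enters: the first theorem with bounded error
    gives crude bounds, and cutting the range of exponents into many short pieces makes them sharp.
    Rounding is harmless: dropping the floors in the subtracted pair sum goes in the right
    direction, and in the single sum it costs at most one per large prime, which Chebyshev's bound
    makes O(n / ln n). *)

Definition log_ratio_primitive (x : R) : R := RInt (fun t => ln (1 - t) / t) (1 / 2) x.

Lemma continuous_log_ratio x :
  0 < x < 1 -> continuous (fun t => ln (1 - t) / t) x.
Proof.
move=> hx; apply: (ex_derive_continuous (V := R_NormedModule)).
by auto_derive; lra.
Qed.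

Lemma ex_RInt_log_ratio a b :
  0 < a < 1 -> 0 < b < 1 -> ex_RInt (fun t => ln (1 - t) / t) a b.
Proof.
move=> ha hb; apply: (ex_RInt_continuous (V := R_CompleteNormedModule)) => t ht.
apply: continuous_log_ratio; move: ht; rewrite /Rmin /Rmax.
by case: (Rle_dec a b) => /= _ ht; lra.
Qed.

Lemma is_derive_log_ratio_primitive x :
  0 < x < 1 -> is_derive log_ratio_primitive x (ln (1 - x) / x).
Proof.
move=> hx; apply: (@is_derive_RInt R_NormedModule (fun t => ln (1 - t) / t) _ (1 / 2)).
- have hpos : 0 < Rmin x (1 - x) by apply: Rmin_pos; lra.
  exists (mkposreal _ hpos) => y hy.
  apply (@RInt_correct R_CompleteNormedModule); apply: ex_RInt_log_ratio; first lra.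
  move: hy; rewrite /ball /= /AbsRing_ball /abs /minus /plus /opp /= => hy.
  have := Rmin_l x (1 - x); have := Rmin_r x (1 - x).
  by move: hy => /Rabs_def2; lra.
- exact: continuous_log_ratio.
Qed.

(** Two moving endpoints become two values of one fixed function, which the chain rule can
    differentiate. Up to sign and an additive constant, [log_ratio_primitive] is the dilogarithm. *)
Lemma c0_objectiveE a : 0 < a < 1 ->
  c0_objective a = - ln a + (ln (1 - a) - ln a) * ln a
    - (log_ratio_primitive (1 - a) - log_ratio_primitive a).
Proof.
move=> ha; rewrite /c0_objective /log_ratio_primitive; congr (_ - _).
have h : forall u v w : R, Rplus u v = w -> v = w - u by move=> u v w <-; ring.
apply: h; apply (@RInt_Chasles R_CompleteNormedModule); apply: ex_RInt_log_ratio; lra.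
Qed.

(** The terms in [ln a / (1 - a)] coming from the product of logarithms and from the endpoint
    [1 - a] cancel. The sign depends only on [(1 - a) / a] compared with [exp (1 / 2)]. *)
Definition c0_derivative (a : R) : R := (2 * ln ((1 - a) / a) - 1) / a.

Lemma is_derive_c0_objective a : 0 < a < 1 -> is_derive c0_objective a (c0_derivative a).
Proof.
move=> ha.
have hpos : 0 < Rmin a (1 - a) by apply: Rmin_pos; lra.
apply: (is_derive_ext_loc (fun a => - ln a + (ln (1 - a) - ln a) * ln a
    - (log_ratio_primitive (1 - a) - log_ratio_primitive a))).
  exists (mkposreal _ hpos) => y hy; rewrite c0_objectiveE //.
  move: hy; rewrite /ball /= /AbsRing_ball /abs /minus /plus /opp /= => hy.
  have := Rmin_l a (1 - a); have := Rmin_r a (1 - a).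
  by move: hy => /Rabs_def2; lra.
have d1 := is_derive_log_ratio_primitive _ ha.
have hb : 0 < 1 - a < 1 by lra.
have d2 := is_derive_log_ratio_primitive _ hb.
have e1 : ex_derive log_ratio_primitive a by eexists; exact: d1.
have e2 : ex_derive log_ratio_primitive (1 - a) by eexists; exact: d2.
have u1 := is_derive_unique _ _ _ d1.
have u2 := is_derive_unique _ _ _ d2.
auto_derive; first by repeat split => //; lra.
rewrite /c0_derivative ln_div; [|lra|lra].
move: u1 u2 => /= -> ->.
replace (1 - (1 - a)) with a by ring.
rewrite -[1 + - a]/(1 - a); field; lra.
Qed.

Definition c0_argmax : R := / (1 + exp (1 / 2)).

(** Squaring reduces it to [exp 1 <= 3 < 4]. It is what places [c0_argmax] above 1/3. *)
Lemma exp_half_lt_2 : exp (1 / 2) < 2.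
Proof.
have h : exp (1/2) * exp (1/2) = exp 1 by rewrite -exp_plus; congr exp; lra.
have := exp_le_3; have := exp_pos (1/2); nra.
Qed.

Lemma c0_argmax_bounds : 1 / 3 < c0_argmax < 1 / 2.
Proof.
have h2 := exp_half_lt_2; have h1 := exp_ineq1 (1/2).
rewrite /c0_argmax; split.
  by rewrite -[1/3]Rmult_1_r; apply: (Rmult_lt_reg_l (1 + exp (1/2))); [lra|rewrite Rinv_r; lra].
apply: (Rmult_lt_reg_l (1 + exp (1/2))); first by lra.
by rewrite Rinv_r; lra.
Qed.

Lemma c0_argmaxK : c0_argmax * (1 + exp (1 / 2)) = 1.
Proof. by apply: Rinv_l; have := exp_pos (1 / 2); lra. Qed.

Lemma c0_derivative_ge0 a : 0 < a <= c0_argmax -> 0 <= c0_derivative a.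
Proof.
have hm := c0_argmax_bounds; move=> ha; rewrite /c0_derivative.
apply: Rdiv_le_0_compat; last lra.
suff : ln (exp (1/2)) <= ln ((1 - a) / a) by rewrite ln_exp; lra.
apply: ln_le; first exact: exp_pos.
have h : a * (1 + exp (1/2)) <= 1.
  by have := c0_argmaxK; have := exp_pos (1 / 2); nra.
by apply: (Rmult_le_reg_l a); [lra|field_simplify; lra].
Qed.

Lemma c0_derivative_le0 a : c0_argmax <= a < 1 -> c0_derivative a <= 0.
Proof.
have hm := c0_argmax_bounds; move=> ha; rewrite /c0_derivative.
have hln : ln ((1 - a) / a) <= ln (exp (1/2)).
  apply: ln_le; first by apply: Rdiv_lt_0_compat; lra.
  have h : 1 <= a * (1 + exp (1/2)).
    by have := c0_argmaxK; have := exp_pos (1 / 2); nra.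
  by apply: (Rmult_le_reg_l a); [lra|field_simplify; lra].
rewrite ln_exp in hln.
have : 0 < / a by apply: Rinv_0_lt_compat; lra.
by rewrite /Rdiv; nra.
Qed.

Lemma derive_ge0_le (f df : R -> R) a b : a <= b ->
  (forall x, a <= x <= b -> is_derive f x (df x)) ->
  (forall x, a <= x <= b -> 0 <= df x) -> f a <= f b.
Proof.
move=> hab hd hp; case: (MVT_gen f a b df) => [x|x|c].
- by rewrite Rmin_left // Rmax_right // => hx; apply: hd; lra.
- rewrite Rmin_left // Rmax_right // => hx; apply/continuity_pt_filterlim.
  by apply: (ex_derive_continuous (V := R_NormedModule)); eexists; apply: hd.
- by rewrite Rmin_left // Rmax_right // => -[hc heq]; have := hp _ hc; nra.
Qed.

(** Replaces integration of inequalities: increments of a transcendental function are bounded by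
    those of an explicit one by comparing derivatives only. *)
Lemma derive_le (f df g dg : R -> R) a b : a <= b ->
  (forall x, a <= x <= b -> is_derive f x (df x)) ->
  (forall x, a <= x <= b -> is_derive g x (dg x)) ->
  (forall x, a <= x <= b -> df x <= dg x) -> f b - f a <= g b - g a.
Proof.
move=> hab hf hg hle.
suff : g a - f a <= g b - f b by lra.
apply: (@derive_ge0_le (fun x => g x - f x) (fun x => dg x - df x) a b) => // x hx.
  by apply: (is_derive_minus (V := R_NormedModule)); [apply: hg|apply: hf].
by have := hle _ hx; lra.
Qed.

Lemma c0_objective_max a : 1 / 3 <= a <= 1 / 2 -> c0_objective a <= c0_objective c0_argmax.
Proof.
have hm := c0_argmax_bounds; move=> ha.
case: (Rle_lt_dec a c0_argmax) => h.
  apply: (@derive_ge0_le _ c0_derivative) => // x hx.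
    by apply: is_derive_c0_objective; lra.
  by apply: c0_derivative_ge0; lra.
suff : - c0_objective c0_argmax <= - c0_objective a by lra.
apply: (@derive_ge0_le (fun x => - c0_objective x) (fun x => - c0_derivative x)); first lra.
  by move=> x hx; apply: (is_derive_opp (V := R_NormedModule)); apply: is_derive_c0_objective; lra.
by move=> x hx; have := @c0_derivative_le0 x; lra.
Qed.

Lemma c0E : c0 = c0_objective c0_argmax.
Proof.
rewrite /c0 (_ : Lub_Rbar _ = Finite (c0_objective c0_argmax)) //.
apply: is_lub_Rbar_unique; split.
  by move=> y [a [ha ->]]; exact: c0_objective_max.
move=> b hb; apply: hb; exists c0_argmax; split=> //.
by have := c0_argmax_bounds; lra.
Qed.

Lemma c0_is_maximum : is_maximum c0_values c0.
Proof.
rewrite c0E; split; last by move=> y [a [ha ->]]; exact: c0_objective_max.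
by exists c0_argmax; split=> //; have := c0_argmax_bounds; lra.
Qed.

(* Truncations of [ln 2 = 2 artanh (1 / 3)]; in the upper bound the factor
   9 / 8 on the last coefficient accounts for the geometric tail of
   [1 / (1 - x ^ 2)] when [x <= 1 / 3]. *)
Lemma ln2_bounds : 0.69314 < ln 2 < 0.6931475.
Proof.
have d0 x : 0 <= x <= 1 / 3 ->
    is_derive (fun x => ln (1 + x) - ln (1 - x)) x (2 / (1 - x ^ 2)).
  by move=> hx; auto_derive; [lra|field; nra].
have e0 : ln (1 + 1 / 3) - ln (1 - 1 / 3) = ln 2.
  by rewrite -ln_div; [congr ln; field|lra|lra].
have e1 : ln (1 + 0) - ln (1 - 0) = 0 by rewrite Rplus_0_r Rminus_0_r; ring.
split.
  pose P x : R := 2 * (x + x ^ 3 / 3 + x ^ 5 / 5 + x ^ 7 / 7 + x ^ 9 / 9).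
  pose dP x : R := 2 * (1 + x ^ 2 + x ^ 4 + x ^ 6 + x ^ 8).
  have := @derive_le P dP (fun x => ln (1 + x) - ln (1 - x))
    (fun x => 2 / (1 - x ^ 2)) 0 (1 / 3).
  rewrite e0 e1 => H.
  suff : P (1 / 3) - P 0 <= ln 2 - 0 by rewrite /P; lra.
  apply: H => //; first lra.
    by move=> x hx; rewrite /P /dP; auto_derive => //; field.
  move=> x hx; have hpos : 1 - x ^ 2 > 0 by nra.
  apply (proj1 (Rle_div_r (dP x) 2 (1 - x ^ 2) hpos)).
  have : 0 <= x ^ 10 by apply: pow_le; lra.
  by rewrite /dP; lra.
pose P x : R := 2 * (x + x ^ 3 / 3 + x ^ 5 / 5 + x ^ 7 / 7 + x ^ 9 / 9 + x ^ 11 / 11 + 9 / 8 * x ^ 13 / 13).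
pose dP x : R := 2 * (1 + x ^ 2 + x ^ 4 + x ^ 6 + x ^ 8 + x ^ 10 + 9 / 8 * x ^ 12).
have := @derive_le (fun x => ln (1 + x) - ln (1 - x)) (fun x => 2 / (1 - x ^ 2)) P dP 0 (1 / 3).
rewrite e0 e1 => H.
suff : ln 2 - 0 <= P (1 / 3) - P 0 by rewrite /P; lra.
apply: H => //; first lra.
  by move=> x hx; rewrite /P /dP; auto_derive => //; field.
move=> x hx; have hpos : 1 - x ^ 2 > 0 by nra.
apply (proj2 (Rle_div_l 2 (dP x) (1 - x ^ 2) hpos)).
have h : 0 <= x ^ 12 * (1 - 9 * x ^ 2).
  by apply: Rmult_le_pos; [apply: pow_le; lra|nra].
by rewrite /dP; lra.
Qed.

Lemma exp_monotone x y : x <= y -> exp x <= exp y.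
Proof. by case=> [h|->]; [left; exact: exp_increasing|right]. Qed.

Definition logistic (s : R) : R := / (1 + exp (- s)).

(** The bounds are Taylor polynomials at 0, whose nonzero terms beyond the constant alternate in
    sign; degrees 3 and 5 are enough for five decimals of [c0]. *)
Lemma logistic_bounds s : 0 <= s <= 1 / 2 ->
  1 / 2 + s / 4 - s ^ 3 / 48 <= logistic s <= 1 / 2 + s / 4 - s ^ 3 / 48 + s ^ 5 / 480.
Proof.
move=> hs.
(* On the scale [ln p - ln (1 - p)] the logistic function is the identity, so comparing with it
   means comparing the derivative [p' / (p (1 - p))] with 1. *)
have from_logit p : 0 < p < 1 -> (ln p - ln (1 - p) <= s -> p <= logistic s) /\
    (s <= ln p - ln (1 - p) -> logistic s <= p).
  move=> hp; have hE : p = logistic (ln p - ln (1 - p)).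
    rewrite /logistic Ropp_minus_distr exp_plus exp_Ropp !exp_ln; try lra.
    by field; lra.
  have mono u v : u <= v -> logistic u <= logistic v.
    move=> huv; apply: Rinv_le_contravar; first by have := exp_pos (- v); lra.
    by apply/Rplus_le_compat_l/exp_monotone; lra.
  by split=> h; rewrite {1}hE; apply: mono.
(* The logistic function solves [p' = p (1 - p)]; a polynomial with the same
   value at 0 that is a sub- or supersolution stays below or above it. *)
pose L x : R := 1 / 2 + x / 4 - x ^ 3 / 48.
pose dL x : R := 1 / 4 - x ^ 2 / 16.
pose U x : R := 1 / 2 + x / 4 - x ^ 3 / 48 + x ^ 5 / 480.
pose dU x : R := 1 / 4 - x ^ 2 / 16 + x ^ 4 / 96.
have pow_bounds x : 0 <= x <= 1 / 2 -> 0 <= x ^ 3 <= x / 4 /\ 0 <= x ^ 5 <= x / 16.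
  move=> hx; have h3 : 0 <= x ^ 3 <= x / 4.
    by replace (x ^ 3) with (x * (x * x)) by ring; nra.
  by split=> //; replace (x ^ 5) with (x ^ 3 * (x * x)) by ring; nra.
have hL x : 0 <= x <= 1 / 2 -> 0 < L x < 1.
  by move=> hx; rewrite /L; have := pow_bounds x hx; lra.
have hU x : 0 <= x <= 1 / 2 -> 0 < U x < 1.
  by move=> hx; rewrite /U; have := pow_bounds x hx; lra.
have logit_half p : p = 1 / 2 -> ln p - ln (1 - p) = 0.
  by move=> ->; replace (1 - 1 / 2) with (1 / 2) by field; ring.
split.
  have [hl _] := from_logit (L s) (hL s hs); apply: hl.
  have := @derive_le (fun x => ln (L x) - ln (1 - L x)) (fun x => dL x / (L x * (1 - L x)))
    (fun x => x) (fun=> 1) 0 s.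
  rewrite (logit_half (L 0)) ?Rminus_0_r; last by rewrite /L; field.
  apply; first lra.
  - move=> x hx; have := hL x; rewrite /L /dL => h; auto_derive; first lra.
    by field; lra.
  - by move=> x hx; apply: (is_derive_id (K := R_AbsRing)).
  - move=> x hx; have hx' : 0 <= x <= 1 / 2 by lra.
    have hl' := hL x hx'; have hpos : L x * (1 - L x) > 0 by nra.
    apply (proj2 (Rle_div_l (dL x) 1 _ hpos)).
    (* Since [L (1 - L) = 1 / 4 - (L - 1 / 2) ^ 2], the bound [L - 1 / 2 <= x / 4] gives
       [dL <= L (1 - L)]. *)
    have : 0 <= L x - 1 / 2 <= x / 4 by have := pow_bounds x hx'; rewrite /L; lra.
    by rewrite /dL; nra.
have [_ hu] := from_logit (U s) (hU s hs); apply: hu.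
have := @derive_le (fun x => x) (fun=> 1) (fun x => ln (U x) - ln (1 - U x))
  (fun x => dU x / (U x * (1 - U x))) 0 s.
rewrite (logit_half (U 0)) ?Rminus_0_r; last by rewrite /U; field.
apply; first lra.
- by move=> x hx; apply: (is_derive_id (K := R_AbsRing)).
- move=> x hx; have := hU x; rewrite /U /dU => h; auto_derive; first lra.
  by field; lra.
- move=> x hx; have hx' : 0 <= x <= 1 / 2 by lra.
  have hu' := hU x hx'; have hpos : U x * (1 - U x) > 0 by nra.
  apply (proj1 (Rle_div_r 1 (dU x) _ hpos)).
  have hp := pow_bounds x hx'.
  (* The square of this lower bound is [x ^ 2 / 16 - x ^ 4 / 96 + x ^ 6 / 2304]; subtracted from 1/4
     it is at most [dU]. *)
  have h : 0 <= x / 4 - x ^ 3 / 48 <= U x - 1 / 2 by rewrite /U; lra.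
  have h2 : (x / 4 - x ^ 3 / 48) * (x / 4 - x ^ 3 / 48) <= (U x - 1 / 2) * (U x - 1 / 2).
    by apply: Rmult_le_compat; lra.
  have h6 : 0 <= x ^ 6 by apply: pow_le; lra.
  by rewrite /dU; lra.
Qed.

(* The substitution [a = 1 / (1 + exp r)] turns the integral defining the
   objective into one of the logistic function over a short interval. *)
Lemma is_derive_c0_objective_logistic r :
  is_derive (fun r => c0_objective (/ (1 + exp r))) r ((1 - 2 * r) * logistic r).
Proof.
have he := exp_pos r.
have ha : 0 < / (1 + exp r) < 1.
  split; first by apply: Rinv_0_lt_compat; lra.
  by rewrite -[X in _ < X]Rinv_1; apply: Rinv_lt_contravar; lra.
have d1 := is_derive_c0_objective _ ha.
have d2 : is_derive (fun r => / (1 + exp r)) r (- exp r / (1 + exp r) ^ 2).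
  by auto_derive; [lra|field; lra].
have := is_derive_comp _ _ _ _ _ d1 d2.
have -> : scal (- exp r / (1 + exp r) ^ 2) (c0_derivative (/ (1 + exp r)))
    = (1 - 2 * r) * logistic r; last by [].
rewrite /scal /= /mult /= /c0_derivative /logistic exp_Ropp.
have -> : (1 - / (1 + exp r)) / / (1 + exp r) = exp r by field; lra.
by rewrite ln_exp; field; lra.
Qed.

(** The parameter [r] runs from 0, where the objective is [ln 2], to 1/2, where it is [c0]. Each [P]
    is the antiderivative of [1 - 2 x] times a Taylor bound of [logistic]. *)
Lemma c0_bounds : 0.82849 <= c0 < 0.82850.
Proof.
rewrite c0E /c0_argmax.
have e0 : c0_objective (/ (1 + exp 0)) = ln 2.
  rewrite exp_0 c0_objectiveE; last lra.
  replace (1 - / (1 + 1)) with (/ (1 + 1)) by field.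
  replace (/ (1 + 1)) with (/ 2) by lra.
  by rewrite ln_Rinv; lra.
have hln := ln2_bounds.
split.
  pose P x : R := x / 2 + x ^ 2 / 8 - x ^ 4 / 192 - x ^ 2 / 2 - x ^ 3 / 6 + x ^ 5 / 120.
  pose dP x : R := (1 - 2 * x) * (1 / 2 + x / 4 - x ^ 3 / 48).
  have h := @derive_le P dP (fun r => c0_objective (/ (1 + exp r)))
    (fun r => (1 - 2 * r) * logistic r) 0 (1 / 2).
  suff : P (1 / 2) - P 0 <= c0_objective (/ (1 + exp (1 / 2))) - ln 2 by rewrite /P; lra.
  rewrite -e0; apply: h; first lra.
  - by move=> x hx; rewrite /P /dP; auto_derive => //; field.
  - by move=> x _; exact: is_derive_c0_objective_logistic.
  - move=> x hx; have := logistic_bounds x hx => hb.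
    by apply: Rmult_le_compat_l; lra.
pose P x : R := x / 2 + x ^ 2 / 8 - x ^ 4 / 192 + x ^ 6 / 2880
  - x ^ 2 / 2 - x ^ 3 / 6 + x ^ 5 / 120 - x ^ 7 / 1680.
pose dP x : R := (1 - 2 * x) * (1 / 2 + x / 4 - x ^ 3 / 48 + x ^ 5 / 480).
have h := @derive_le (fun r => c0_objective (/ (1 + exp r)))
  (fun r => (1 - 2 * r) * logistic r) P dP 0 (1 / 2).
suff : c0_objective (/ (1 + exp (1 / 2))) - ln 2 <= P (1 / 2) - P 0 by rewrite /P; lra.
rewrite -e0; apply: h; first lra.
- by move=> x _; exact: is_derive_c0_objective_logistic.
- by move=> x hx; rewrite /P /dP; auto_derive => //; field.
- move=> x hx; have := logistic_bounds x hx => hb.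
  by apply: Rmult_le_compat_l; lra.
Qed.

(** * Chebyshev's bound on primorials *)

Lemma prime_dvd_fact p n : prime p -> (p %| n`! -> p <= n)%N.
Proof.
move=> pp; elim: n => [|n IH]; first by rewrite dvdn1 => /eqP h; rewrite h in pp.
by rewrite factS Euclid_dvdM // => /orP[/dvdn_leq -> //|/IH /leqW].
Qed.

Lemma prod_primes_dvd a b N :
  (forall p, (a <= p < b)%N -> prime p -> p %| N)%N ->
  (\prod_(a <= p < b | prime p) p %| N)%N.
Proof.
case: (leqP b a) => [hba _|hab]; first by rewrite big_geq // dvd1n.
rewrite -(subnKC (ltnW hab)); elim: (b - a)%N => [|m IH] h.
  by rewrite addn0 big_geq // dvd1n.
rewrite addnS big_mkcond big_nat_recr ?leq_addr //=.
have hm : (\prod_(a <= i < a + m) (if prime i then i else 1) %| N)%N.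
  by rewrite -big_mkcond; apply: IH => p hp; apply: h; lia.
case: ifP => pp; last by rewrite muln1.
rewrite Gauss_dvd ?hm ?h //; first by lia.
rewrite big_nat; apply: (big_ind (fun x => coprime x (a + m))).
- exact: coprime1n.
- by move=> x y hx hy; rewrite coprimeMl hx.
- move=> i hi; case: ifP => pi; last exact: coprime1n.
  by rewrite prime_coprime // dvdn_prime2 //; lia.
Qed.

(** The expansion of (1 + 1)^(2m+1) contains this coefficient twice, at m and at m + 1. *)
Lemma odd_central_bin_le m : ('C(m.*2.+1, m) <= 4 ^ m)%N.
Proof.
suff : (2 * 'C(m.*2.+1, m) <= 2 * 4 ^ m)%N by rewrite leq_pmul2l.
have -> : (2 * 4 ^ m = 2 ^ m.*2.+1)%N by rewrite expnS -mul2n expnM.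
have hm : (m < m.*2.+2)%N by lia.
have hm1 : (m.+1 < m.*2.+2)%N by lia.
rewrite -[2%N in leqRHS]/(1 + 1)%N expnDn.
rewrite (bigD1 (Ordinal hm)) //= (bigD1 (Ordinal hm1)) /=; last first.
  by rewrite -val_eqE /=; lia.
rewrite !exp1n !muln1 addnA mul2n -addnn.
have -> : 'C(m.*2.+1, m.+1) = 'C(m.*2.+1, m).
  by rewrite -bin_sub; [congr ('C(_, _)); lia | lia].
exact: leq_addr.
Qed.

(** Erdős's induction: an even n > 2 adds no prime, and for n = 2m + 1 the primes in (m + 1, n] all
    divide the binomial coefficient of n and m. *)
Lemma primorial_le n : (\prod_(0 <= p < n.+1 | prime p) p <= 4 ^ n)%N.
Proof.
have [k] := ubnP n; elim: k n => // k IH n hn.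
case: (ltnP n 3) => [|h3].
  by case: n hn => [|[|[|]]] // _ _; rewrite /index_iota /= !big_cons big_nil.
case: (boolP (odd n)) => ho; last first.
  rewrite big_mkcond big_nat_recr //= -big_mkcond (negbTE (_ : ~~ prime n)) ?muln1; last first.
    by apply/negP => /even_prime [h|h]; [move: h3; rewrite h|rewrite h in ho].
  move: h3 hn; case: n ho => // n ho h3 hn.
  by apply: leq_trans (IH n _) _; [lia|rewrite leq_exp2l].
have [m hm] : exists m, n = m.*2.+1 by exists n./2; rewrite -[LHS]odd_double_half ho.
rewrite (@big_cat_nat _ _ _ m.+2) /=; [|lia|lia].
apply: (@leq_trans (4 ^ m.+1 * 4 ^ m)); last by rewrite -expnD leq_exp2l //; lia.
apply: leq_mul; first by apply: IH; lia.
apply: leq_trans (odd_central_bin_le m).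
apply: dvdn_leq; first by rewrite bin_gt0; lia.
apply: prod_primes_dvd => p hp pp.
(* In [n! = 'C(n, m) * (m! * (n - m)!)] both factorials have arguments at most m + 1 < p, so p must
   divide the binomial coefficient. *)
have : (p %| n`!)%N by apply: dvdn_fact; have := prime_gt0 pp; lia.
rewrite -(@bin_fact n m); last lia.
rewrite Euclid_dvdM // => /orP[|]; first by rewrite hm.
rewrite Euclid_dvdM // => /orP[] /(prime_dvd_fact _ _ pp); lia.
Qed.

Lemma logn_fact_le p n : prime p -> ((p - 1) * logn p n`! <= n)%N.
Proof.
move=> pp; rewrite logn_fact //.
(* Keeping the last quotient [n %/ p ^ m] makes the geometric sum in Legendre's formula telescope
   despite the floors. *)
suff : forall m, ((p - 1) * (\sum_(1 <= k < m.+1) n %/ p ^ k) + n %/ p ^ m <= n)%N.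
  by move=> h; exact: leq_trans (leq_addr _ _) (h n).
elim=> [|m IH]; first by rewrite big_geq // muln0 expn0 divn1.
apply: leq_trans IH; rewrite big_nat_recr //= mulnDr -addnA leq_add2l.
rewrite expnSr divnMA; set q := (n %/ _)%N.
by have := leq_divM q p; have := prime_gt1 pp; nia.
Qed.

(** * Mertens' first theorem *)

Lemma Rplus_associative : associative Rplus.
Proof. by move=> x y z; rewrite Rplus_assoc. Qed.

HB.instance Definition _ :=
  Monoid.isComLaw.Build R 0 Rplus Rplus_associative Rplus_comm Rplus_0_l.

Notation "\rsum_ ( i <- r | P ) F" := (\big[Rplus/0]_(i <- r | P%B) F)
  (at level 41, F at level 41, i, r at level 50,
   format "'[' \rsum_ ( i  <-  r  |  P ) '/  '  F ']'") : R_scope.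
Notation "\rsum_ ( m <= i < n | P ) F" := (\big[Rplus/0]_(m <= i < n | P%B) F)
  (at level 41, F at level 41, i, m, n at level 50,
   format "'[' \rsum_ ( m  <=  i  <  n  |  P ) '/  '  F ']'") : R_scope.
Notation "\rsum_ ( m <= i < n ) F" := (\big[Rplus/0]_(m <= i < n) F)
  (at level 41, F at level 41, i, m, n at level 50,
   format "'[' \rsum_ ( m  <=  i  <  n ) '/  '  F ']'") : R_scope.

Lemma rsum_le (I : eqType) (r : seq I) (P : pred I) (F G : I -> R) :
  (forall i, i \in r -> P i -> F i <= G i) ->
  \rsum_(i <- r | P i) F i <= \rsum_(i <- r | P i) G i.
Proof.
move=> h; rewrite !(big_seq_cond P); apply: (big_ind2 Rle) => //; first exact: Rle_refl.
  by move=> *; exact: Rplus_le_compat.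
by move=> i /andP[]; exact: h.
Qed.

Lemma rsum_scale (I : Type) (r : seq I) (P : pred I) (F : I -> R) c :
  c * (\rsum_(i <- r | P i) F i) = \rsum_(i <- r | P i) (c * F i).
Proof. by apply: (big_morph (Rmult c)); [move=> x y; ring | ring]. Qed.

Lemma rsum_ge0 (I : eqType) (r : seq I) (P : pred I) (F : I -> R) :
  (forall i, i \in r -> P i -> 0 <= F i) -> 0 <= \rsum_(i <- r | P i) F i.
Proof.
move=> h; rewrite big_seq_cond; apply: (big_ind (Rle 0)); first exact: Rle_refl.
  by move=> *; exact: Rplus_le_le_0_compat.
by move=> i /andP[]; exact: h.
Qed.

Lemma INR_muln m n : INR (m * n)%N = INR m * INR n.
Proof. exact: mult_INR. Qed.

Lemma INR_addn m n : INR (m + n)%N = INR m + INR n.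
Proof. exact: plus_INR. Qed.

Lemma INR_leq m n : (m <= n)%N -> INR m <= INR n.
Proof. by move=> /leP; exact: le_INR. Qed.

Lemma INR_ltn m n : (m < n)%N -> INR m < INR n.
Proof. by move=> /ltP; exact: lt_INR. Qed.

Lemma INR_gt0 n : (0 < n)%N -> 0 < INR n.
Proof. exact: INR_ltn. Qed.

Lemma INR_leqE m n : INR m <= INR n -> (m <= n)%N.
Proof. by move=> /INR_le /leP. Qed.

Lemma INR_expn m k : INR (m ^ k)%N = INR m ^ k.
Proof. by elim: k => [//|k IH]; rewrite expnS INR_muln IH. Qed.

Lemma ln_ge0 x : 1 <= x -> 0 <= ln x.
Proof. by move=> h; rewrite -ln_1; apply: ln_le; lra. Qed.

Lemma ln_INR_ge0 n : 0 <= ln (INR n).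
Proof.
case: n => [|n]; last by apply: ln_ge0; exact: (@INR_leq 1).
(* The case n = 0 relies on the default value [ln 0 = 0]. *)
by rewrite /ln /=; case: (Rlt_dec 0 0) => [h|_]; [case: (Rlt_irrefl 0)|apply: Rle_refl].
Qed.

Lemma ln_prod (I : eqType) (r : seq I) (P : pred I) (F : I -> nat) :
  (forall i, i \in r -> P i -> (0 < F i)%N) ->
  ln (INR (\prod_(i <- r | P i) F i)) = \rsum_(i <- r | P i) ln (INR (F i)).
Proof.
move=> h; rewrite !(big_seq_cond P).
suff [] : (0 < \prod_(i <- r | (i \in r) && P i) F i)%N /\
  ln (INR (\prod_(i <- r | (i \in r) && P i) F i)) =
    \rsum_(i <- r | (i \in r) && P i) ln (INR (F i)) by [].
apply: (big_ind2 (fun m x => (0 < m)%N /\ ln (INR m) = x)).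
- by split=> //; rewrite ln_1.
- move=> m1 x1 m2 x2 [h1 <-] [h2 <-]; rewrite muln_gt0 h1 h2; split=> //.
  by rewrite INR_muln ln_mult //; apply: INR_gt0.
- by move=> i /andP[hi Pi]; split=> //; exact: h.
Qed.

Definition prime_sum (F : nat -> R) (a b : nat) : R := \rsum_(a.+1 <= p < b.+1 | prime p) F p.

Lemma prime_sum_le F G a b :
  (forall p, prime p -> (a < p <= b)%N -> F p <= G p) -> prime_sum F a b <= prime_sum G a b.
Proof. by move=> h; apply: rsum_le => p; rewrite mem_index_iota ltnS => hp pp; exact: h. Qed.

Lemma prime_sum_ge0 F a b :
  (forall p, prime p -> (a < p <= b)%N -> 0 <= F p) -> 0 <= prime_sum F a b.
Proof. by move=> h; apply: rsum_ge0 => p; rewrite mem_index_iota ltnS => hp pp; exact: h. Qed.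

Lemma prime_sum_scale c F a b : c * prime_sum F a b = prime_sum (fun p => c * F p) a b.
Proof. exact: rsum_scale. Qed.

Lemma prime_sum_add F G a b :
  prime_sum (fun p => F p + G p) a b = prime_sum F a b + prime_sum G a b.
Proof. exact: big_split. Qed.

Lemma prime_sum_cat F a b c :
  (a <= b)%N -> (b <= c)%N -> prime_sum F a c = prime_sum F a b + prime_sum F b c.
Proof. by move=> hab hbc; rewrite /prime_sum (@big_cat_nat _ _ _ b.+1). Qed.

Lemma theta_le n : prime_sum (fun p => ln (INR p)) 0 n <= INR n * ln 4.
Proof.
rewrite /prime_sum -ln_prod; last by move=> p _ /prime_gt0.
have h4 : INR 4 = 4 by rewrite /=; ring.
rewrite -h4 -ln_pow; last by apply: INR_gt0.
rewrite -INR_expn; apply: ln_le.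
  by apply/INR_gt0/prodn_cond_gt0 => p /prime_gt0.
by apply: INR_leq; have := primorial_le n; rewrite [X in (X <= _)%N]big_ltn_cond.
Qed.

Lemma ln_fact_prime_sum n :
  ln (INR n`!) = prime_sum (fun p => INR (logn p n`!) * ln (INR p)) 0 n.
Proof.
have hn : (n.+1 <= (n`!).+1)%N by rewrite ltnS; elim: n => // n IH; rewrite factS; have := fact_gt0 n; nia.
have hE : n`! = \prod_(1 <= p < n.+1 | prime p) p ^ logn p n`!.
  (* This factorization runs over all indices up to [n!]; those above n have exponent 0 and are
     split off. *)
  rewrite -[LHS](partnT (fact_gt0 n)) (widen_partn _ (leqnn _)).
  rewrite big_ltn //= {1}lognE /= expn0 mul1n (@big_cat_nat _ _ _ n.+1) //=.
  rewrite [X in (_ * X)%N]big_nat [X in (_ * X)%N]big1 ?muln1; last first.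
    move=> p /andP[hp _]; case: (boolP (prime p)) => pp; last by rewrite lognE (negbTE pp).
    rewrite lognE pp fact_gt0; case: ifP => // /(prime_dvd_fact _ _ pp) h.
    by move: (leq_trans hp h); rewrite ltnn.
  rewrite [RHS]big_mkcond /=; apply: eq_bigr => p _.
  by case: ifP => // pp; rewrite lognE pp.
rewrite {1}hE ln_prod; last by move=> p _ pp; rewrite expn_gt0 prime_gt0.
apply: eq_bigr => p pp; rewrite INR_expn ln_pow //; exact/INR_gt0/prime_gt0.
Qed.

Lemma ln_succ_le n : (0 < n)%N -> ln (INR n.+1) <= ln (INR n) + / INR n.
Proof.
move=> hn; have h := INR_gt0 _ hn; have h' := Rinv_0_lt_compat _ h.
have -> : INR n.+1 = INR n * (1 + / INR n) by rewrite S_INR; field; lra.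
rewrite ln_mult; [|lra|lra].
suff : ln (1 + / INR n) <= ln (exp (/ INR n)) by rewrite ln_exp; lra.
by apply: ln_le; [lra|have := exp_ineq1_le (/ INR n); lra].
Qed.

Lemma ln_fact_ge n : INR n * ln (INR n) - INR n <= ln (INR n`!).
Proof.
elim: n => [|n IH]; first by rewrite /= ln_1; lra.
rewrite factS INR_muln ln_mult; [|exact: INR_gt0|exact/INR_gt0/fact_gt0].
case: (posnP n) => [->|hn]; first by rewrite /= ln_1; lra.
have h := ln_succ_le _ hn; have h0 := INR_gt0 _ hn.
have h1 : INR n * ln (INR n.+1) <= INR n * ln (INR n) + 1.
  by apply: Rle_trans (Rmult_le_compat_l _ _ _ (Rlt_le _ _ h0) h) _; right; field; lra.
by move: h1 IH; rewrite S_INR; lra.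
Qed.

Lemma ln_fact_le n : ln (INR n`!) <= INR n * ln (INR n).
Proof.
elim: n => [|n IH]; first by rewrite /= ln_1; lra.
rewrite factS INR_muln ln_mult; [|exact: INR_gt0|exact/INR_gt0/fact_gt0].
have h : INR n * ln (INR n) <= INR n * ln (INR n.+1).
  apply: Rmult_le_compat_l; first exact: pos_INR.
  case: (posnP n) => [->|hn]; first rewrite /= ln_1 /ln.
    by case: (Rlt_dec 0 0) => [/Rlt_irrefl//|_]; exact: Rle_refl.
  by apply: ln_le; [exact: INR_gt0|exact: INR_leq].
by move: h IH; rewrite !S_INR; lra.
Qed.

(** The right-hand side has derivative [(ln x + 1) / x ^ 2]; the surplus over [ln x / x ^ 2] absorbs
    the passage from integral to sum, and equality at n = 1 starts the induction. *)
Lemma sum_ln_over_square_le n : (0 < n)%N ->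
  \rsum_(1 <= m < n.+1) (ln (INR m) / INR m ^ 2) <= 2 - (ln (INR n) + 2) / INR n.
Proof.
case: n => // n _; elim: n => [|n IH].
  by rewrite big_nat1 /= ln_1; right; field.
rewrite big_nat_recr //=; apply: Rle_trans (Rplus_le_compat_r _ _ _ IH) _.
have hx : 1 <= INR n.+1 by exact: (@INR_leq 1).
have hl := ln_succ_le n.+1 isT; have h0 := ln_INR_ge0 n.+1.
have hE : INR n.+2 = INR n.+1 + 1 by rewrite S_INR.
rewrite -/(INR n.+2) hE in hl *; set x := INR n.+1 in hx hl h0 *.
set l := ln x in hl h0 *; set l' := ln (x + 1) in hl *.
suff : l' / (x + 1) ^ 2 <= (l + 2) / x - (l' + 2) / (x + 1) by rewrite /=; lra.
have hi : 0 < / x <= 1.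
  by split; [apply: Rinv_0_lt_compat; lra|rewrite -[X in _ <= X]Rinv_1; apply: Rinv_le_contravar; lra].
have xi : x * / x = 1 by apply: Rinv_r; lra.
have -> : (l + 2) / x - (l' + 2) / (x + 1) = ((x + 1) * (l + 2) - x * (l' + 2)) / (x * (x + 1)).
  by field; lra.
apply: (@Rle_trans _ ((l + 1) / (x * (x + 1)))).
  apply: (@Rle_trans _ ((l + / x) / (x + 1) ^ 2)).
    apply: Rmult_le_compat_r => //; left; apply: Rinv_0_lt_compat; nra.
  have -> : (l + / x) / (x + 1) ^ 2 = ((l + / x) * (x / (x + 1))) / (x * (x + 1)) by field; lra.
  apply: Rmult_le_compat_r; first by left; apply: Rinv_0_lt_compat; nra.
  have : 0 <= x / (x + 1) <= 1.
    split; first by apply: Rdiv_le_0_compat; lra.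
    by apply (proj2 (Rle_div_l x 1 (x + 1) ltac:(lra))); lra.
  by nra.
apply: Rmult_le_compat_r; first by left; apply: Rinv_0_lt_compat; nra.
by nra.
Qed.

Definition mertens_sum (n : nat) : R := prime_sum (fun p => ln (INR p) / INR p) 0 n.

(** The exponent of p in [n!] is at least [n / p - 1]. The lost units add up to at most [n * ln 4]
    by Chebyshev's bound, and [ln 4 <= 2]. *)
Lemma mertens_sum_le n : (0 < n)%N -> mertens_sum n <= ln (INR n) + 2.
Proof.
move=> hn; have h0 := INR_gt0 _ hn.
have hth := theta_le n; have hf := ln_fact_le n.
suff h : INR n * mertens_sum n - prime_sum (fun p => ln (INR p)) 0 n <= ln (INR n`!).
  have h4 : ln 4 <= 2.
    have -> : 4 = 2 * 2 by ring.
    by rewrite ln_mult; have := ln2_bounds; lra.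
  by apply: (Rmult_le_reg_l (INR n)) => //; nra.
rewrite ln_fact_prime_sum /mertens_sum prime_sum_scale.
suff : prime_sum (fun p => INR n * (ln (INR p) / INR p)) 0 n <=
  prime_sum (fun p => INR (logn p n`!) * ln (INR p) + ln (INR p)) 0 n.
  by rewrite prime_sum_add; lra.
apply: prime_sum_le => p pp hp; have hp0 := INR_gt0 _ (prime_gt0 pp).
have h : INR n <= (INR (logn p n`!) + 1) * INR p.
  rewrite -S_INR -INR_muln; apply: INR_leq.
  apply: leq_trans (ltnW (ltn_ceil n (prime_gt0 pp))) _.
  rewrite leq_mul2r ltnS logn_fact // (big_ltn (_ : 1 < n.+1)%N) ?ltnS // expn1 leq_addr orbT //.
have -> : INR n * (ln (INR p) / INR p) = INR n / INR p * ln (INR p) by field; lra.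
rewrite -[X in _ <= _ + X]Rmult_1_l -Rmult_plus_distr_r.
apply: Rmult_le_compat_r; first exact: ln_INR_ge0.
by apply (proj2 (Rle_div_l _ _ _ hp0)).
Qed.

(** Of the 5, one comes from [ln_fact_ge] and four from the higher powers of p in [n!], whose
    contribution is at most [2 n] times a sum bounded by 2. *)
Lemma mertens_sum_ge n : (0 < n)%N -> ln (INR n) - 5 <= mertens_sum n.
Proof.
move=> hn; have h0 := INR_gt0 _ hn; have hf := ln_fact_ge n.
suff h : ln (INR n`!) <= INR n * mertens_sum n + INR n * 4.
  by apply: (Rmult_le_reg_l (INR n)) => //; nra.
have hs : prime_sum (fun p => ln (INR p) / INR p ^ 2) 0 n <= 2.
  apply: Rle_trans (_ : 2 - (ln (INR n) + 2) / INR n <= _); last first.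
    have : 0 <= (ln (INR n) + 2) / INR n by apply: Rdiv_le_0_compat => //; have := ln_INR_ge0 n; lra.
    by lra.
  apply: Rle_trans (sum_ln_over_square_le _ hn); rewrite /prime_sum big_mkcond.
  apply: rsum_le => p; rewrite mem_index_iota => /andP[hp _] _; have hp0 := INR_gt0 _ hp.
  case: ifP => _; first exact: Rle_refl.
  by apply: Rdiv_le_0_compat; [exact: ln_INR_ge0|nra].
rewrite ln_fact_prime_sum.
apply: (@Rle_trans _ (INR n * mertens_sum n +
   (INR n * 2) * prime_sum (fun p => ln (INR p) / INR p ^ 2) 0 n)); last by nra.
rewrite /mertens_sum !prime_sum_scale -prime_sum_add; apply: prime_sum_le => p pp hp.
have hp1 : 2 <= INR p by exact: (@INR_leq 2 _ (prime_gt1 pp)).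
have hL := ln_INR_ge0 p.
have h : (INR p - 1) * INR (logn p n`!) <= INR n.
  have := INR_leq _ _ (logn_fact_le _ n pp); rewrite INR_muln minus_INR //.
  by apply/leP; exact: prime_gt0.
(* Uses [1 / (p - 1) <= 1 / p + 2 / p ^ 2], which is equivalent to [p >= 2]. *)
have h2 : INR (logn p n`!) <= INR n / INR p + 2 * INR n / INR p ^ 2.
  apply: (@Rle_trans _ (INR n / (INR p - 1))).
    by apply (proj1 (Rle_div_r _ (INR n) (INR p - 1) ltac:(lra))); lra.
  have -> : INR n / INR p + 2 * INR n / INR p ^ 2 = INR n * ((INR p + 2) / INR p ^ 2) by field; lra.
  apply: Rmult_le_compat_l; first lra.
  apply (proj1 (Rle_div_r _ _ (INR p ^ 2) ltac:(nra))).
  rewrite Rmult_comm; apply (proj2 (Rle_div_l _ _ (INR p - 1) ltac:(lra))); nra.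
apply: Rle_trans (Rmult_le_compat_r _ _ _ hL h2) _.
by right; field; lra.
Qed.

(** * Mertens' second theorem *)

Definition nat_floor (x : R) : nat := Z.to_nat (Int_part x).

Lemma nat_floor_bounds x : 0 <= x -> INR (nat_floor x) <= x < INR (nat_floor x) + 1.
Proof.
move=> hx; have [h1 h2] := base_Int_part x.
have hz : (-1 < Int_part x)%Z by apply: lt_IZR; lra.
by rewrite /nat_floor INR_IZR_INZ Z2Nat.id; [lra|lia].
Qed.

(** The integer part of n^u, used through the threshold [ln p <= u * ln n]. At n = 0 the default
    [ln 0 = 0] makes it 1. *)
Definition power_floor (n : nat) (u : R) : nat := nat_floor (exp (u * ln (INR n))).

Lemma ln_le_power_floor n u p : (0 < p)%N -> (p <= power_floor n u)%N -> ln (INR p) <= u * ln (INR n).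
Proof.
move=> hp /INR_leq h; rewrite -[X in _ <= X]ln_exp; apply: ln_le; first exact: INR_gt0.
by have [] := nat_floor_bounds _ (Rlt_le _ _ (exp_pos (u * ln (INR n)))); move: h; rewrite /power_floor; lra.
Qed.

Lemma power_floor_ge n u p : (0 < p)%N -> ln (INR p) <= u * ln (INR n) -> (p <= power_floor n u)%N.
Proof.
move=> hp h; rewrite -ltnS; apply/ltP/INR_lt; rewrite S_INR.
have [_] := nat_floor_bounds _ (Rlt_le _ _ (exp_pos (u * ln (INR n)))); apply: Rle_lt_trans.
by rewrite -(exp_ln (INR p)); [exact: exp_monotone|exact: INR_gt0].
Qed.

Lemma power_floor_lt n u p : (power_floor n u < p)%N -> u * ln (INR n) < ln (INR p).
Proof.
move=> h; apply: Rnot_le_lt => h'.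
by have := power_floor_ge _ _ _ (leq_ltn_trans (leq0n _) h) h'; rewrite leqNgt h.
Qed.

Lemma power_floor_gt0 n u : 0 <= u -> (0 < power_floor n u)%N.
Proof.
move=> hu; apply: power_floor_ge => //; rewrite ln_1.
by apply: Rmult_le_pos => //; exact: ln_INR_ge0.
Qed.

Lemma power_floor_mono n u v : 0 <= u <= v -> (power_floor n u <= power_floor n v)%N.
Proof.
move=> huv; have h := power_floor_gt0 n u huv.1; apply: power_floor_ge => //.
apply: Rle_trans (ln_le_power_floor _ _ _ h (leqnn _)) _.
by apply: Rmult_le_compat_r; [exact: ln_INR_ge0|lra].
Qed.

Lemma power_floor1 n : (0 < n)%N -> power_floor n 1 = n.
Proof.
move=> hn; apply/eqP; rewrite eqn_leq; apply/andP; split.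
  have h := ln_le_power_floor n 1 _ (power_floor_gt0 n 1 _) (leqnn _).
  apply: INR_leqE; apply: Rnot_lt_le => /(ln_increasing _ _ (INR_gt0 _ hn)).
  by have := h Rle_0_1; lra.
by apply: power_floor_ge => //; lra.
Qed.

Lemma ln_power_floor_ge n u : 0 <= u -> u * ln (INR n) - 1 <= ln (INR (power_floor n u)).
Proof.
move=> hu; have := power_floor_lt n u _ (leqnn (power_floor n u).+1).
have h := ln_succ_le _ (power_floor_gt0 n u hu).
have : / INR (power_floor n u) <= 1.
  rewrite -[X in _ <= X]Rinv_1; apply: Rinv_le_contravar; first lra.
  by apply: (INR_leq 1); exact: power_floor_gt0.
by lra.
Qed.

Definition reciprocal_sum (n : nat) (u v : R) : R :=
  prime_sum (fun p => / INR p) (power_floor n u) (power_floor n v).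

Lemma reciprocal_sum_ge0 n u v : 0 <= reciprocal_sum n u v.
Proof.
apply: prime_sum_ge0 => p pp _; left; apply: Rinv_0_lt_compat; exact/INR_gt0/prime_gt0.
Qed.

Lemma reciprocal_sum_cat n u v w : 0 <= u <= v -> v <= w ->
  reciprocal_sum n u w = reciprocal_sum n u v + reciprocal_sum n v w.
Proof. by move=> huv hvw; apply: prime_sum_cat; apply: power_floor_mono; lra. Qed.

(** The 8 is 2 + 5 from the two sides of Mertens' first theorem plus 1 for the rounding of one
    endpoint. *)
Lemma mertens_sum_diff n u v : 0 <= u <= v ->
  (v - u) * ln (INR n) - 8 <=
    prime_sum (fun p => ln (INR p) / INR p) (power_floor n u) (power_floor n v)
  <= (v - u) * ln (INR n) + 8.
Proof.
move=> huv; have hu := power_floor_gt0 n u huv.1; have hv := power_floor_gt0 n v ltac:(lra).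
have := mertens_sum_le _ hu; have := mertens_sum_ge _ hu.
have := mertens_sum_le _ hv; have := mertens_sum_ge _ hv.
rewrite {1 2}/mertens_sum (prime_sum_cat _ _ _ _ (leq0n _) (power_floor_mono n u v huv)).
rewrite -/(mertens_sum (power_floor n u)).
have := ln_power_floor_ge n u huv.1; have := ln_power_floor_ge n v ltac:(lra).
have := ln_le_power_floor n u _ hu (leqnn _); have := ln_le_power_floor n v _ hv (leqnn _).
by lra.
Qed.

(** On this range [ln p] exceeds [u * ln n], so each [1 / p] is at most [ln p / p] divided by
    [u * ln n]. The main term [(v - u) / u] approximates [ln (v / u)] only when [v / u] is near
    1. *)
Lemma reciprocal_sum_le n u v : 0 < u <= v -> 0 < ln (INR n) ->
  reciprocal_sum n u v <= (v - u) / u + 8 / u / ln (INR n).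
Proof.
move=> huv hn; set l := ln (INR n) in hn *.
have -> : (v - u) / u + 8 / u / l = / (u * l) * ((v - u) * l + 8) by field; lra.
have hi : 0 < / (u * l) by apply/Rinv_0_lt_compat/Rmult_lt_0_compat; lra.
have [_ h] := mertens_sum_diff n u v ltac:(lra).
apply: Rle_trans (Rmult_le_compat_l _ _ _ (Rlt_le _ _ hi) h).
rewrite prime_sum_scale; apply: prime_sum_le => p pp /andP[/power_floor_lt hp _].
have hp0 := INR_gt0 _ (prime_gt0 pp); rewrite -/l in hp.
have -> : / (u * l) * (ln (INR p) / INR p) = (/ (u * l) * ln (INR p)) * / INR p by field; lra.
rewrite -[X in X <= _]Rmult_1_l; apply: Rmult_le_compat_r; first by left; exact: Rinv_0_lt_compat.
by apply: (Rmult_le_reg_l (u * l)); [nra|field_simplify; lra].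
Qed.

Lemma reciprocal_sum_ge n u v : 0 < u <= v -> 0 < ln (INR n) ->
  (v - u) / v - 8 / v / ln (INR n) <= reciprocal_sum n u v.
Proof.
move=> huv hn; set l := ln (INR n) in hn *.
have -> : (v - u) / v - 8 / v / l = / (v * l) * ((v - u) * l - 8) by field; lra.
have hi : 0 < / (v * l) by apply/Rinv_0_lt_compat/Rmult_lt_0_compat; lra.
have [h _] := mertens_sum_diff n u v ltac:(lra).
apply: Rle_trans (Rmult_le_compat_l _ _ _ (Rlt_le _ _ hi) h) _.
rewrite prime_sum_scale; apply: prime_sum_le => p pp /andP[_ /(ln_le_power_floor _ _ _ (prime_gt0 pp)) hp].
have hp0 := INR_gt0 _ (prime_gt0 pp); rewrite -/l in hp.
have -> : / (v * l) * (ln (INR p) / INR p) = (/ (v * l) * ln (INR p)) * / INR p by field; lra.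
rewrite -[X in _ <= X]Rmult_1_l; apply: Rmult_le_compat_r; first by left; exact: Rinv_0_lt_compat.
by apply: (Rmult_le_reg_l (v * l)); [nra|field_simplify; lra].
Qed.

Lemma eventually_ln_ge K : eventually (fun n => K <= ln (INR n)).
Proof.
exists (nat_floor (exp K)).+1 => n /leP /INR_leq hn.
have [_] := nat_floor_bounds _ (Rlt_le _ _ (exp_pos K)); rewrite S_INR in hn => h.
by rewrite -(ln_exp K); apply: ln_le; [exact: exp_pos|lra].
Qed.

Lemma eventually_div_ln_le c eps : 0 < eps ->
  eventually (fun n => 0 < ln (INR n) /\ c / ln (INR n) <= eps).
Proof.
move=> he; apply: filter_imp (filter_and _ _ (eventually_ln_ge 1) (eventually_ln_ge (c / eps))).
move=> n [h1 h2]; split; first lra.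
apply (proj2 (Rle_div_l c eps (ln (INR n)) ltac:(lra))).
by move/(Rle_div_l c (ln (INR n)) eps he): h2; lra.
Qed.

(** With exponents in geometric progression every piece has the same main term [exp h - 1], so the
    pieces add up to a multiple of it. *)
Lemma reciprocal_sum_geometric_le u h N eps : 0 < u -> 0 < h -> 0 < eps ->
  eventually (fun n => reciprocal_sum n u (u * exp (INR N * h)) <= INR N * (exp h - 1) + eps).
Proof.
move=> hu hh; elim: N eps => [|N IH] eps he.
  apply: filter_imp (eventually_div_ln_le (8 / u) eps he) => n [h1 h2].
  apply: Rle_trans (reciprocal_sum_le _ _ _ _ h1) _; rewrite /= Rmult_0_l exp_0 Rmult_1_r; first lra.
  have -> : (u - u) / u = 0 by field; lra.
  lra.
set v := u * exp (INR N * h) in IH *.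
have hv : u <= v.
  rewrite -[X in X <= _]Rmult_1_r; apply: Rmult_le_compat_l; first lra.
  rewrite -exp_0; apply: exp_monotone; apply: Rmult_le_pos; [exact: pos_INR|lra].
have -> : u * exp (INR N.+1 * h) = v * exp h.
  by rewrite /v S_INR Rmult_plus_distr_r exp_plus Rmult_1_l; ring.
have hvw : v <= v * exp h by have := exp_ineq1_le h; nra.
have he2 : 0 < eps / 2 by lra.
apply: filter_imp (filter_and _ _ (IH _ he2) (eventually_div_ln_le (8 / v) _ he2)).
move=> n [h1 [h2 h3]].
rewrite (reciprocal_sum_cat n u v (v * exp h)) ?S_INR; [|lra|lra].
have := reciprocal_sum_le n v (v * exp h) ltac:(lra) h2.
have -> : (v * exp h - v) / v = exp h - 1 by field; lra.
by lra.
Qed.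

Lemma reciprocal_sum_geometric_ge u h N eps : 0 < u -> 0 < h -> 0 < eps ->
  eventually (fun n => INR N * (1 - exp (- h)) - eps <= reciprocal_sum n u (u * exp (INR N * h))).
Proof.
move=> hu hh; elim: N eps => [|N IH] eps he.
  by exists 0%N => n _; have := reciprocal_sum_ge0 n u (u * exp (INR 0 * h)); rewrite /=; lra.
set v := u * exp (INR N * h) in IH *.
have hv : u <= v.
  rewrite -[X in X <= _]Rmult_1_r; apply: Rmult_le_compat_l; first lra.
  rewrite -exp_0; apply: exp_monotone; apply: Rmult_le_pos; [exact: pos_INR|lra].
have -> : u * exp (INR N.+1 * h) = v * exp h.
  by rewrite /v S_INR Rmult_plus_distr_r exp_plus Rmult_1_l; ring.
have hvw : v <= v * exp h by have := exp_ineq1_le h; nra.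
have he2 : 0 < eps / 2 by lra.
apply: filter_imp (filter_and _ _ (IH _ he2) (eventually_div_ln_le (8 / (v * exp h)) _ he2)).
move=> n [h1 [h2 h3]].
rewrite (reciprocal_sum_cat n u v (v * exp h)) ?S_INR; [|lra|lra].
have := reciprocal_sum_ge n v (v * exp h) ltac:(lra) h2.
have -> : (v * exp h - v) / (v * exp h) = 1 - exp (- h).
  by rewrite exp_Ropp; field; split; [have := exp_pos h; lra|lra].
by lra.
Qed.

Lemma exp_bounds h : 0 < h <= 1 / 2 ->
  exp h - 1 <= h + 2 * h ^ 2 /\ h - 2 * h ^ 2 <= 1 - exp (- h).
Proof.
move=> hh; have h1 := exp_ineq1_le h; have h2 := exp_ineq1_le (- h).
have e : exp h * exp (- h) = 1 by rewrite -exp_plus Rplus_opp_r exp_0.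
have := exp_pos h; have := exp_pos (- h); split; nra.
Qed.

Lemma fine_subdivision L eps : 0 < L -> 0 < eps ->
  (* The witness exceeds [2 L + 2 L ^ 2 / eps]: the first term makes the step at most 1/2, the
     second controls the error. *)
  exists N : nat, (0 < N)%N /\ 0 < L / INR N <= 1 / 2 /\ 2 * L * (L / INR N) <= eps.
Proof.
move=> hL he; pose x := 2 * L + 2 * L * L / eps.
have hx : 0 < x.
  have : 0 < 2 * L * L / eps by apply: Rdiv_lt_0_compat; nra.
  by rewrite /x; lra.
have [_ hf] := nat_floor_bounds x (Rlt_le _ _ hx).
exists (nat_floor x).+1; split=> //; rewrite -S_INR in hf; set y := INR _ in hf *.
split; first split.
- by apply: Rdiv_lt_0_compat; lra.
- apply (proj2 (Rle_div_l L _ y ltac:(lra))).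
  have : 0 < 2 * L * L / eps by apply: Rdiv_lt_0_compat; nra.
  by move: hf; rewrite /x; lra.
have -> : 2 * L * (L / y) = (2 * L * L) / y by field; lra.
apply (proj2 (Rle_div_l _ _ y ltac:(lra))).
have h : 2 * L * L / eps <= y by move: hf; rewrite /x; lra.
by move/(Rle_div_l _ _ _ he): h; lra.
Qed.

(** The total [N h] stays equal to [ln (v / u)], while the quadratic errors sum to at most
    [2 N h ^ 2], which is small for large N. *)
Lemma geometric_subdivision u v eps : 0 < u < v -> 0 < eps ->
  exists (N : nat) (h : R), [/\ 0 < h, v = u * exp (INR N * h),
    INR N * (exp h - 1) <= ln (v / u) + eps & ln (v / u) - eps <= INR N * (1 - exp (- h))].
Proof.
move=> huv he.
have hq : 1 < v / u by apply (proj1 (Rlt_div_r 1 v u ltac:(lra))); lra.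
have hL : 0 < ln (v / u) by rewrite -ln_1; apply: ln_increasing; lra.
have [N [hN [hh hle]]] := fine_subdivision _ eps hL he.
exists N, (ln (v / u) / INR N); have hN0 := INR_gt0 _ hN.
set h := _ / INR N in hh hle *.
have hNh : INR N * h = ln (v / u) by rewrite /h; field; lra.
have [b1 b2] := exp_bounds h hh; split; first lra.
- by rewrite hNh exp_ln; [field|]; lra.
- apply: Rle_trans (Rmult_le_compat_l _ _ _ (Rlt_le _ _ hN0) b1) _.
  have -> : INR N * (h + 2 * h ^ 2) = INR N * h + 2 * (INR N * h) * h by ring.
  by rewrite hNh; lra.
- apply: Rle_trans (Rmult_le_compat_l _ _ _ (Rlt_le _ _ hN0) b2).
  have -> : INR N * (h - 2 * h ^ 2) = INR N * h - 2 * (INR N * h) * h by ring.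
  by rewrite hNh; lra.
Qed.

Lemma reciprocal_sum_limsup u v eps : 0 < u < v -> 0 < eps ->
  eventually (fun n => reciprocal_sum n u v <= ln (v / u) + eps).
Proof.
move=> huv he.
have [N [h [hh hv hle _]]] := geometric_subdivision u v (eps / 2) huv ltac:(lra).
have := reciprocal_sum_geometric_le u h N (eps / 2) huv.1 hh ltac:(lra).
by apply: filter_imp => n; rewrite -hv; lra.
Qed.

Lemma reciprocal_sum_liminf u v eps : 0 < u < v -> 0 < eps ->
  eventually (fun n => ln (v / u) - eps <= reciprocal_sum n u v).
Proof.
move=> huv he.
have [N [h [hh hv _ hge]]] := geometric_subdivision u v (eps / 2) huv ltac:(lra).
have := reciprocal_sum_geometric_ge u h N (eps / 2) huv.1 hh ltac:(lra).
by apply: filter_imp => n; rewrite -hv; lra.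
Qed.

(** * Pairs of large primes *)

(** The sum of 1 / (p q) over ordered pairs. The inner range stops at [n %/ p] because larger q have
    no multiple of p q up to n; [v] is free so that the outer range can grow step by step. *)
Definition pair_sum (n : nat) (u v : R) : R :=
  prime_sum (fun p => / INR p * prime_sum (fun q => / INR q) (power_floor n u) (n %/ p))
    (power_floor n u) (power_floor n v).

Lemma prime_sum_widen F a b c : (b <= c)%N ->
  (forall p, prime p -> 0 <= F p) -> prime_sum F a b <= prime_sum F a c.
Proof.
move=> hbc hF; case: (leqP a b) => hab.
  by rewrite (prime_sum_cat F a b c hab hbc); have := prime_sum_ge0 F b c (fun p pp _ => hF p pp); lra.
by rewrite {1}/prime_sum big_geq ?ltnS ?(ltnW hab) //; apply: prime_sum_ge0 => p pp _; exact: hF.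
Qed.

Lemma inv_INR_prime_ge0 p : prime p -> 0 <= / INR p.
Proof. by move=> pp; left; apply/Rinv_0_lt_compat/INR_gt0/prime_gt0. Qed.

Lemma divn_le_power_floor n v p : 0 <= v <= 1 -> (power_floor n v < p)%N ->
  (n %/ p <= power_floor n (1 - v))%N.
Proof.
move=> hv hp; case: (posnP (n %/ p)) => [->//|hq]; apply: power_floor_ge => //.
have hp0 : (0 < p)%N by exact: leq_ltn_trans hp.
have := power_floor_lt _ _ _ hp.
suff : ln (INR (n %/ p)) + ln (INR p) <= ln (INR n) by lra.
rewrite -ln_mult; [|exact: INR_gt0|exact: INR_gt0].
rewrite -INR_muln; apply: ln_le; first by apply: INR_gt0; rewrite muln_gt0 hq.
by apply: INR_leq; exact: leq_divM.
Qed.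

(** A prime p > n^v leaves q at most n^(1-v), so the new pairs lie in a product of two ranges. *)
Lemma pair_sum_step n u v w : 0 <= u <= v -> v <= w -> v <= 1 ->
  pair_sum n u w <= pair_sum n u v + reciprocal_sum n v w * reciprocal_sum n u (1 - v).
Proof.
move=> huv hvw hv1; rewrite /pair_sum (prime_sum_cat _ (power_floor n u) (power_floor n v));
  [|by apply: power_floor_mono; lra|by apply: power_floor_mono; lra].
apply: Rplus_le_compat_l; rewrite Rmult_comm {1}/reciprocal_sum prime_sum_scale.
apply: prime_sum_le => p pp /andP[hp _]; rewrite Rmult_comm.
apply: Rmult_le_compat_r; first exact: inv_INR_prime_ge0.
apply: prime_sum_widen; last exact: inv_INR_prime_ge0.
by apply: divn_le_power_floor => //; lra.
Qed.

(** Once p > n^(1-u), no large q fits below n / p. *)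
Lemma pair_sum_full n u : 0 <= u <= 1 / 2 -> pair_sum n u 1 <= pair_sum n u (1 - u).
Proof.
move=> hu; have := @pair_sum_step n u (1 - u) 1 ltac:(lra) ltac:(lra) ltac:(lra).
have -> : 1 - (1 - u) = u by ring.
have -> : reciprocal_sum n u u = 0 by rewrite /reciprocal_sum /prime_sum big_geq.
by lra.
Qed.

Lemma eventually_mult_le (a b : nat -> R) A B eps : 0 <= A -> 0 <= B -> 0 < eps ->
  (forall n, 0 <= a n) -> (forall n, 0 <= b n) ->
  (forall e, 0 < e -> eventually (fun n => a n <= A + e)) ->
  (forall e, 0 < e -> eventually (fun n => b n <= B + e)) ->
  eventually (fun n => a n * b n <= A * B + eps).
Proof.
(* With [e <= 1], the excess [e (A + B + e)] of [(A + e) (B + e)] over [A B] is at most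
   [e (A + B + 1)]. *)
move=> hA hB he a0 b0 ha hb; pose e := Rmin 1 (eps / (A + B + 1)).
have hq : 0 < eps / (A + B + 1) by apply: Rdiv_lt_0_compat; lra.
have e0 : 0 < e by apply: Rmin_pos; lra.
have e1 : e <= 1 by exact: Rmin_l.
have e2 : e * (A + B + 1) <= eps.
  by apply (proj2 (Rle_div_r e eps (A + B + 1) ltac:(lra))); exact: Rmin_r.
apply: filter_imp (filter_and _ _ (ha e e0) (hb e e0)) => n [h1 h2].
apply: (@Rle_trans _ ((A + e) * (B + e))); first by apply: Rmult_le_compat.
by nra.
Qed.

(** The limiting density of pairs at p = n^x: [1 / x] for p, times [ln ((1 - x) / u)] for q between
    n^u and n^(1-x). *)
Definition tail_ratio (u x : R) : R := (ln (1 - x) - ln u) / x.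

Definition tail_ratio_primitive (u x : R) : R :=
  log_ratio_primitive x - log_ratio_primitive u - ln u * (ln x - ln u).

Lemma is_derive_tail_ratio_primitive u x : 0 < x < 1 ->
  is_derive (tail_ratio_primitive u) x (tail_ratio u x).
Proof.
move=> hx; have d1 := is_derive_log_ratio_primitive x hx.
have e1 : ex_derive log_ratio_primitive x by eexists; exact: d1.
have u1 := is_derive_unique _ _ _ d1.
rewrite /tail_ratio_primitive; auto_derive; first by split => //; lra.
by move: u1 => /= ->; rewrite /tail_ratio; field; lra.
Qed.

Lemma tail_ratio_antimono u x y : 0 < u <= x -> x <= y <= 1 - u ->
  0 <= tail_ratio u y <= tail_ratio u x.
Proof.
move=> hux hxy; rewrite /tail_ratio.
have h1 : ln u <= ln (1 - y) by apply: ln_le; lra.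
have h2 : ln (1 - y) <= ln (1 - x) by apply: ln_le; lra.
split; first by apply: Rdiv_le_0_compat; lra.
apply: Rmult_le_compat; [lra| |lra|by apply: Rinv_le_contravar; lra].
by left; apply: Rinv_0_lt_compat; lra.
Qed.

Lemma c0_objective_tail_ratio u : 0 < u < 1 ->
  c0_objective u = - ln u - tail_ratio_primitive u (1 - u).
Proof. by move=> hu; rewrite c0_objectiveE // /tail_ratio_primitive; ring. Qed.

(** An upper Riemann sum with left endpoints. As [tail_ratio u] decreases, the overshoot on each
    piece is at most [step] times its drop there, and the drops telescope. *)
Lemma pair_sum_riemann u N i eps : 0 < u < 1 / 2 -> (0 < N)%N -> (i <= N)%N -> 0 < eps ->
  let step := (1 - 2 * u) / INR N in let x := u + INR i * step in
  eventually (fun n => pair_sum n u x <=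
    tail_ratio_primitive u x + step * (tail_ratio u u - tail_ratio u x) + eps).
Proof.
move=> hu hN hi he step; move: he; have hN0 := INR_gt0 _ hN.
have hs : 0 < step by apply: Rdiv_lt_0_compat; lra.
have hNs : INR N * step = 1 - 2 * u by rewrite /step; field; lra.
elim: i hi eps => [|i IH] hi eps he x.
  rewrite /x /= Rmult_0_l Rplus_0_r; exists 0%N => n _.
  by rewrite {1}/pair_sum /prime_sum big_geq // /tail_ratio_primitive; lra.
have hiN : INR i.+1 * step <= INR N * step.
  by apply: Rmult_le_compat_r; [lra|exact: INR_leq].
have := IH (ltnW hi) (eps / 2) ltac:(lra).
rewrite /x S_INR; rewrite S_INR in hiN.
have hi0 : 0 <= INR i * step by apply: Rmult_le_pos; [exact: pos_INR|lra].
set y := u + INR i * step => hy.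
have -> : u + (INR i + 1) * step = y + step by rewrite /y; ring.
have hyu : u <= y by rewrite /y; lra.
have hyu' : y + step <= 1 - u by rewrite /y; lra.
have hr := tail_ratio_antimono u y (y + step) ltac:(lra) ltac:(lra).
have hG : step * tail_ratio u (y + step) <=
    tail_ratio_primitive u (y + step) - tail_ratio_primitive u y.
  have -> : step * tail_ratio u (y + step) =
    tail_ratio u (y + step) * (y + step) - tail_ratio u (y + step) * y by ring.
  apply: (@derive_le (fun x => tail_ratio u (y + step) * x) (fun=> tail_ratio u (y + step))
    (tail_ratio_primitive u) (tail_ratio u) y (y + step)); first by lra.
  - by move=> z hz; auto_derive => //; ring.
  - by move=> z hz; apply: is_derive_tail_ratio_primitive; lra.
  - by move=> z hz; have := tail_ratio_antimono u z (y + step); lra.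
have hprod : eventually (fun n => reciprocal_sum n y (y + step) * reciprocal_sum n u (1 - y)
    <= step / y * ln ((1 - y) / u) + eps / 2).
  apply: eventually_mult_le.
  - by apply: Rdiv_le_0_compat; lra.
  - by apply: ln_ge0; apply (proj1 (Rle_div_r 1 (1 - y) u ltac:(lra))); lra.
  - by lra.
  - by move=> n; exact: reciprocal_sum_ge0.
  - by move=> n; exact: reciprocal_sum_ge0.
  (* The crude bound [step / y] suffices here: it already gives the left-endpoint value of the
     integrand. *)
  - move=> e e0; apply: filter_imp (eventually_div_ln_le (8 / y) e e0) => n [h1 h2].
    have := reciprocal_sum_le n y (y + step) ltac:(lra) h1.
    have -> : y + step - y = step by ring.
    by lra.
  - by move=> e e0; apply: reciprocal_sum_limsup => //; lra.
apply: filter_imp (filter_and _ _ hy hprod) => n [h1 h2].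
have := @pair_sum_step n u y (y + step) ltac:(lra) ltac:(lra) ltac:(lra).
have hE : step / y * ln ((1 - y) / u) = step * tail_ratio u y.
  by rewrite ln_div /tail_ratio; [field|..]; lra.
rewrite hE in h2; lra.
Qed.

Lemma pair_sum_limsup u eps : 0 < u < 1 / 2 -> 0 < eps ->
  eventually (fun n => pair_sum n u 1 <= tail_ratio_primitive u (1 - u) + eps).
Proof.
move=> hu he; have [hr _] := tail_ratio_antimono u u u ltac:(lra) ltac:(lra).
set c := (1 - 2 * u) * tail_ratio u u.
have hc : 0 <= c by apply: Rmult_le_pos; lra.
have hq : 0 <= c / (eps / 2) by apply: Rdiv_le_0_compat; lra.
(* The integrand vanishes at [1 - u], so the total overshoot is [c / N]; N is chosen to make it at
   most [eps / 2]. *)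
have [_] := nat_floor_bounds _ hq; rewrite -S_INR.
set N := (nat_floor _).+1 => hN; have hN0 : 0 < INR N by lra.
have := @pair_sum_riemann u N N (eps / 2) hu isT (leqnn N) ltac:(lra); cbv zeta.
have -> : u + INR N * ((1 - 2 * u) / INR N) = 1 - u by field; lra.
apply: filter_imp => n h; apply: Rle_trans (pair_sum_full n u ltac:(lra)) _.
apply: Rle_trans h _.
have -> : tail_ratio u (1 - u) = 0.
  have e : 1 - (1 - u) = u by ring.
  by rewrite /tail_ratio e /Rminus Rplus_opp_r /Rdiv Rmult_0_l.
have : c / INR N <= eps / 2.
  apply (proj2 (Rle_div_l c (eps / 2) (INR N) hN0)).
  by move/Rlt_le/(Rle_div_l c (INR N) (eps / 2) ltac:(lra)): hN; lra.
have -> : (1 - 2 * u) / INR N * (tail_ratio u u - 0) = c / INR N by rewrite /c; field; lra.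
by lra.
Qed.

(** * Numbers with exactly one large prime factor *)

(** Omega restricted to primes above y. The cutoff n loses no prime factor of a number m with 0 < m
    <= n. *)
Definition prime_multiplicity (y n m : nat) : nat := \sum_(y.+1 <= p < n.+1 | prime p) logn p m.

Lemma prime_multiplicityM y n a b : (0 < a)%N -> (0 < b)%N ->
  prime_multiplicity y n (a * b) = (prime_multiplicity y n a + prime_multiplicity y n b)%N.
Proof.
by move=> ha hb; rewrite /prime_multiplicity -big_split; apply: eq_bigr => p _; exact: lognM.
Qed.

Lemma prime_multiplicityX y n a d :
  prime_multiplicity y n (a ^ d) = (d * prime_multiplicity y n a)%N.
Proof. by rewrite /prime_multiplicity big_distrr; apply: eq_bigr => p _; exact: lognX. Qed.

Lemma prime_multiplicity_prod y n k (F : 'I_k -> nat) : (forall i, 0 < F i)%N ->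
  prime_multiplicity y n (\prod_(i < k) F i) = \sum_(i < k) prime_multiplicity y n (F i).
Proof.
move=> hF.
suff [] : (0 < \prod_(i < k) F i)%N /\ prime_multiplicity y n (\prod_(i < k) F i) =
  \sum_(i < k) prime_multiplicity y n (F i) by [].
apply: (big_ind2 (fun m x : nat => (0 < m)%N /\ prime_multiplicity y n m = x)).
- by split=> //; rewrite /prime_multiplicity big1 // => p _; exact: logn1.
- by move=> m1 x1 m2 x2 [h1 <-] [h2 <-]; rewrite muln_gt0 h1 h2 prime_multiplicityM.
- by [].
Qed.

Definition one_large_prime (y n : nat) : {set 'I_n.+1} :=
  [set m : 'I_n.+1 | (0 < m)%N && (prime_multiplicity y n m == 1%N)].

Lemma one_large_prime_trivial y n d k : (2 <= d)%N -> ~~ (d %| k)%N ->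
  only_trivial_solutions k d (one_large_prime y n).
Proof.
move=> hd hk; split; first by rewrite inE.
move=> a x ha hx; exfalso; move/negP: hk; apply.
have hpos i : (0 < tnth a i)%N by have := ha i; rewrite inE => /andP[].
(* The integer x may be negative; the product is not, so x can be replaced by its absolute value. *)
have hX : (\prod_(i < k) tnth a i = Z.abs_nat x ^ d)%N.
  apply: Nat2Z.inj; rewrite -[LHS]Z.abs_eq; last exact: Nat2Z.is_nonneg.
  rewrite hx Z.abs_pow -Zabs2Nat.id_abs.
  by elim: (d) => [//|e IH]; rewrite expnS Nat2Z.inj_mul -IH Nat2Z.inj_succ Z.pow_succ_r //; exact: Nat2Z.is_nonneg.
have := prime_multiplicity_prod y n _ (fun i => nat_of_ord (tnth a i)) hpos.
rewrite /= hX prime_multiplicityX => h; apply/dvdnP; exists (prime_multiplicity y n (Z.abs_nat x)).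
rewrite mulnC h (eq_bigr (fun=> 1%N)) ?sum1_card ?card_ord // => i _.
by have := ha i; rewrite inE => /andP[_ /eqP].
Qed.

Lemma max_size_ge k d n (A : {set 'I_n.+1}) :
  only_trivial_solutions k d A -> (#|A| <= max_size k d n)%N.
Proof. by move=> hA; apply: (@leq_bigmax_cond _ _ (fun A : {set 'I_n.+1} => #|A|)); apply/asboolP. Qed.

(* A number with at least two large prime factors has, for each of its large
   primes [p], a large prime [q] with [p * q] dividing it. *)
Lemma one_large_prime_pointwise y n m : (0 < m)%N ->
  (\sum_(y.+1 <= p < n.+1 | prime p) (p %| m) <= (prime_multiplicity y n m == 1) +
    \sum_(y.+1 <= p < n.+1 | prime p) \sum_(y.+1 <= q < n.+1 | prime q) (p * q %| m))%N.
Proof.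
move=> hm; case: eqP => [h1|h1].
  apply: (@leq_trans (prime_multiplicity y n m)); last by rewrite h1 leq_addr.
  apply: leq_sum => p pp.
  by rewrite lognE pp hm; case: (p %| m)%N.
rewrite add0n big_seq_cond [leqRHS]big_seq_cond.
apply: leq_sum => p /andP[hp pp]; case: (boolP (p %| m)%N) => // hpm.
suff [q [hq pq hpq]] : exists q, [/\ q \in index_iota y.+1 n.+1, prime q & (p * q %| m)%N].
  by rewrite big_mkcond (bigD1_seq q) ?iota_uniq //= pq hpq.
have hl : (0 < logn p m)%N by rewrite logn_gt0 mem_primes pp hm.
case: (leqP 2 (logn p m)) => hl2.
  by exists p; split=> //; rewrite mulnn pfactor_dvdn.
move: h1; rewrite /prime_multiplicity big_mkcond (bigD1_seq p) ?iota_uniq //= pp.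
have -> : logn p m = 1%N by lia.
set S := \sum_(_ <- _ | _) _ => h1.
have : S != 0%N by lia.
rewrite sum_nat_seq_neq0 => /hasP[q hq /andP[hqp]]; case: ifP => // pq hl'.
exists q; split=> //; rewrite Gauss_dvd ?hpm /=.
  by move: hl'; rewrite -lt0n logn_gt0 mem_primes => /and3P[].
by rewrite prime_coprime // dvdn_prime2 // eq_sym.
Qed.

Lemma one_large_prime_count y n :
  (\sum_(y.+1 <= p < n.+1 | prime p) n %/ p <= #|one_large_prime y n| +
    \sum_(y.+1 <= p < n.+1 | prime p) \sum_(y.+1 <= q < n.+1 | prime q) n %/ (p * q))%N.
Proof.
have -> : #|one_large_prime y n| = \sum_(1 <= m < n.+1) (prime_multiplicity y n m == 1%N).
  rewrite -sum1_card (eq_bigl (fun m : 'I_n.+1 => (0 < m)%N && (prime_multiplicity y n m == 1%N))); last first.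
    by move=> m; rewrite inE.
  rewrite big_mkcond /= -(big_mkord xpredT
    (fun m => if (0 < m)%N && (prime_multiplicity y n m == 1%N) then 1%N else 0%N)).
  rewrite big_ltn //= add0n [LHS]big_nat [RHS]big_nat; apply: eq_bigr => m /andP[-> _].
  by case: eqP.
(* Each quotient is written as a count of multiples up to n; exchanging sums puts m outside, where
   the pointwise inequality applies. *)
rewrite (eq_bigr _ (fun p _ => divn_count_dvd p n)) exchange_big /=.
under [X in (_ + X)%N]eq_bigr => p _.
  rewrite (eq_bigr _ (fun q _ => divn_count_dvd (p * q) n)) exchange_big /=; over.
rewrite [X in (_ <= _ + X)%N]exchange_big -big_split /= [leqLHS]big_nat [leqRHS]big_nat.
by apply: leq_sum => m /andP[hm _]; exact: one_large_prime_pointwise.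
Qed.

Lemma INR_sum (I : Type) (r : seq I) (P : pred I) (F : I -> nat) :
  INR (\sum_(i <- r | P i) F i) = \rsum_(i <- r | P i) INR (F i).
Proof. by apply: (big_morph INR) => //; exact: INR_addn. Qed.

Lemma INR_divn_le n p : (0 < p)%N -> INR (n %/ p) <= INR n * / INR p.
Proof.
move=> hp; apply (proj1 (Rle_div_r _ _ _ (INR_gt0 _ hp))).
by rewrite -INR_muln; apply: INR_leq; exact: leq_divM.
Qed.

Lemma INR_divn_ge n p : (0 < p)%N -> INR n * / INR p - 1 <= INR (n %/ p).
Proof.
move=> hp; suff : INR n / INR p <= INR (n %/ p) + 1 by rewrite /Rdiv; lra.
apply (proj2 (Rle_div_l _ _ _ (INR_gt0 _ hp))).
by rewrite -S_INR -INR_muln; apply: INR_leq; apply/ltnW/ltn_ceil.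
Qed.

(** The quotient is 0 for [q > n %/ p], which truncates the range; on the rest the floor is
    dropped. *)
Lemma prime_sum_inner_le n y p : (0 < p)%N ->
  prime_sum (fun q => INR (n %/ (p * q))) y n <=
    INR n * (/ INR p * prime_sum (fun q => / INR q) y (n %/ p)).
Proof.
move=> hp; rewrite -Rmult_assoc prime_sum_scale.
have hle : (n %/ p <= n)%N by exact: leq_div.
have h0 a : (n %/ p <= a)%N -> prime_sum (fun q => INR (n %/ (p * q))) a n = 0.
  move=> ha; rewrite /prime_sum big_nat_cond big1 // => q /andP[/andP[hq _] _].
  by rewrite divnMA divn_small // (leq_ltn_trans ha hq).
case: (leqP y (n %/ p)) => hy.
  rewrite (prime_sum_cat _ y (n %/ p) n hy hle) h0 // Rplus_0_r.
  apply: prime_sum_le => q pq _; have hq := prime_gt0 pq.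
  rewrite Rmult_assoc -Rinv_mult -INR_muln; apply: INR_divn_le.
  by rewrite muln_gt0 hp.
rewrite h0 ?(ltnW hy) //; apply: prime_sum_ge0 => q pq _.
apply: Rmult_le_pos; last exact: inv_INR_prime_ge0.
apply: Rmult_le_pos; first exact: pos_INR.
by left; apply/Rinv_0_lt_compat/INR_gt0.
Qed.

(** Each large prime contributes more than [u * ln n] to Chebyshev's theta function, which is at
    most [n * ln 4]. This bounds the rounding loss in the single sum. *)
Lemma large_prime_count_le n u : (0 < n)%N -> 0 < u -> 0 < ln (INR n) ->
  prime_sum (fun=> 1) (power_floor n u) n <= INR n * (ln 4 / u / ln (INR n)).
Proof.
move=> hn hu hl; set l := ln (INR n) in hl *.
have hul : 0 < u * l by exact: Rmult_lt_0_compat.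
have -> : INR n * (ln 4 / u / l) = / (u * l) * (INR n * ln 4) by field; lra.
apply: Rle_trans (Rmult_le_compat_l _ _ _ (Rlt_le _ _ (Rinv_0_lt_compat _ hul)) (theta_le n)).
rewrite prime_sum_scale.
apply: Rle_trans (_ : prime_sum (fun p => / (u * l) * ln (INR p)) (power_floor n u) n <= _).
  apply: prime_sum_le => p pp /andP[/power_floor_lt hp _]; rewrite -/l in hp.
  by apply: (Rmult_le_reg_l (u * l)) => //; rewrite -Rmult_assoc Rinv_r; lra.
have hF p : 0 <= / (u * l) * ln (INR p).
  by apply: Rmult_le_pos; [left; exact: Rinv_0_lt_compat|exact: ln_INR_ge0].
case: (leqP (power_floor n u) n) => h.
  rewrite [X in _ <= X](prime_sum_cat _ 0 (power_floor n u) n (leq0n _) h).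
  by have := prime_sum_ge0 (fun p => / (u * l) * ln (INR p)) 0 (power_floor n u) (fun p _ _ => hF p); lra.
by rewrite {1}/prime_sum big_geq ?ltnS ?(ltnW h) //; apply: prime_sum_ge0 => p _ _; exact: hF.
Qed.

Lemma one_large_prime_density n u : (0 < n)%N -> 0 < u -> 0 < ln (INR n) ->
  reciprocal_sum n u 1 - ln 4 / u / ln (INR n) - pair_sum n u 1 <=
    INR #|one_large_prime (power_floor n u) n| / INR n.
Proof.
move=> hn hu hl; have hn0 := INR_gt0 _ hn.
apply (proj1 (Rle_div_r _ _ _ hn0)).
have h1 := INR_leq _ _ (one_large_prime_count (power_floor n u) n).
rewrite INR_addn !INR_sum in h1.
have h2 := large_prime_count_le n u hn hu hl.
have h3 : INR n * reciprocal_sum n u 1 - prime_sum (fun=> 1) (power_floor n u) n <=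
    prime_sum (fun p => INR (n %/ p)) (power_floor n u) n.
  rewrite /reciprocal_sum power_floor1 // prime_sum_scale.
  suff : prime_sum (fun p => INR n * / INR p) (power_floor n u) n <=
    prime_sum (fun p => INR (n %/ p) + 1) (power_floor n u) n by rewrite prime_sum_add; lra.
  by apply: prime_sum_le => p pp _; have := INR_divn_ge n p (prime_gt0 pp); lra.
have h4 : prime_sum (fun p => prime_sum (fun q => INR (n %/ (p * q))) (power_floor n u) n)
    (power_floor n u) n <= INR n * pair_sum n u 1.
  rewrite /pair_sum power_floor1 // prime_sum_scale.
  by apply: prime_sum_le => p pp _; exact/prime_sum_inner_le/prime_gt0.
have h5 : \rsum_((power_floor n u).+1 <= p < n.+1 | prime p)
    INR (\sum_((power_floor n u).+1 <= q < n.+1 | prime q) n %/ (p * q)) =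
  prime_sum (fun p => prime_sum (fun q => INR (n %/ (p * q))) (power_floor n u) n) (power_floor n u) n.
  by apply: eq_bigr => p _; exact: INR_sum.
rewrite h5 in h1; rewrite /prime_sum in h2 h3 h4 h1; lra.
Qed.

Lemma max_size_density d k u eps : (2 <= d)%N -> ~~ (d %| k)%N ->
  0 < u < 1 / 2 -> 0 < eps ->
  eventually (fun n => c0_objective u - eps <= INR (max_size k d n) / INR n).
Proof.
move=> hd hk hu he; have he3 : 0 < eps / 3 by lra.
have hu1 : 0 < u < 1 by lra.
apply: filter_imp (filter_and _ _ (reciprocal_sum_liminf u 1 _ hu1 he3)
  (filter_and _ _ (pair_sum_limsup u _ hu he3)
    (filter_and _ _ (eventually_div_ln_le (ln 4 / u) _ he3) (eventually_ln_ge 1)))).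
move=> n [h1 [h2 [[h3 h4] h5]]].
have hn : (0 < n)%N.
  (* For n = 0 the default [ln 0 = 0] contradicts [1 <= ln n]. *)
  case: n h5 {h1 h2 h3 h4} => // ; rewrite /= /ln; case: (Rlt_dec 0 0) => [/Rlt_irrefl//|_]; lra.
apply: Rle_trans (_ : INR #|one_large_prime (power_floor n u) n| / INR n <= _); last first.
  apply: Rmult_le_compat_r; first by left; apply/Rinv_0_lt_compat/INR_gt0.
  by apply: INR_leq; apply: max_size_ge; exact: one_large_prime_trivial.
apply: Rle_trans (one_large_prime_density n u hn hu.1 h3).
rewrite c0_objective_tail_ratio //.
rewrite ln_div in h1; try lra.
rewrite ln_1 in h1; lra.
Qed.

Theorem theorem6 :
  is_maximum c0_values c0 /\
  0.82849 <= c0 < 0.82850 /\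
  forall d k : nat, (2 <= d)%N -> (0 < k)%N -> ~~ (d %| k)%N ->
    Rbar_le (Finite c0) (LimInf_seq (fun n : nat => INR (max_size k d n) / INR n)).
Proof.
split; first exact: c0_is_maximum.
split; first exact: c0_bounds.
move=> d k hd _ hk; have hm := c0_argmax_bounds.
have lower eps : 0 < eps ->
    Rbar_le (Finite (c0 - eps)) (LimInf_seq (fun n => INR (max_size k d n) / INR n)).
  move=> he; rewrite -(LimInf_seq_const (c0 - eps)); apply: LimInf_le.
  by rewrite c0E; apply: max_size_density => //; lra.
(* The value is an extended real: plus infinity is immediate, and minus infinity contradicts any
   finite lower bound. *)
case: (LimInf_seq _) lower => [l| |] //= lower.
  by apply: le_epsilon => eps he; have := lower eps he; lra.
by have := lower 1 Rlt_0_1.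
Qed.
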